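(* Let $R$ be a nonzero polynomial and $q$ a polynomial without constant term, with complex coefficients, and put $d=\deg R$, $l=\deg q$. Let $H=x\partial_x$, $G=R(H)\partial_x$ and $P_n^q(x)=e^{q(G)}x^n$, $n\ge0$. Then the polynomials $P_n^q(x)$ have the following properties: (i) They are the eigenfunctions of the differential operator $$L:=q'(G)G+x\partial_x$$ with the eigenvalues $\lambda(n)=n$, i.e. $LP_n^q=nP_n^q$. (ii) They satisfy a recurrence relation of the form $$xP^q_n(x)=P^q_{n+1}(x)+\sum_{j=0}^{ld+l-1}\gamma_j(n)P^q_{n-j}(x).$$ (iii) They possess the Hahn property, i.e. their derivatives are of the same class, with the new operator $\hat G=R(H+1)\partial_x$: the system $Q_{n-1}(x)=\frac1n\,\partial_xP_n^q(x)$, $n=1,2,\dots$, is the system corresponding to $q(\hat G)$, that is, $Q_{n-1}(x)=e^{q(\hat G)}x^{n-1}$.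
   Context: All operators act on $\mathbb{C}[x]$. For an operator $A$ on $\mathbb{C}[x]$ lowering the degree of every polynomial, $e^{A}x^n=\sum_{j\ge0}\frac{A^jx^n}{j!}$, a finite sum. In (ii), the $\gamma_j(n)$ are coefficients depending on $n$ and not on $x$, and terms with negative index $n-j$ are absent. *)

(* Defs.v *)
From HB Require Import structures.
From mathcomp Require Import all_boot all_order all_algebra.
From mathcomp Require Import reals.
From mathcomp Require Import complex.

Set Implicit Arguments.
Unset Strict Implicit.
Unset Printing Implicit Defensive.

Import Order.TTheory GRing.Theory Num.Theory.
Local Open Scope ring_scope.

Section Operators.
Variable F : fieldType.
Implicit Types (p q S : {poly F}) (A B : {poly F} -> {poly F}).

Definition opD p : {poly F} := p^`().

Definition opH p : {poly F} := 'X * opD p.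

Definition opH1 p : {poly F} := opH p + p.

(* S(A) = \sum_i S_i A^i. Linear maps on {poly F} carry no algType structure in
   the library (the space is infinite-dimensional), so horner_alg does not
   apply. *)
Definition poly_op S A p : {poly F} := \sum_(i < size S) S`_i *: iter i A p.

(* S(A) \partial_x *)
Definition opG S A p : {poly F} := poly_op S A (opD p).

(* The case p = 0 reads A 0 = 0, and a nonzero constant p is sent to 0. *)
Definition lowers_degree A := forall p, (size (A p) <= (size p).-1)%N.

(* The series \sum_(j >= 0) A^j p / j!, for A lowering degrees; cutting it at
   j < size p only drops zero terms, see exp_opE. *)
Definition exp_op A p : {poly F} :=
  \sum_(j < size p) (j`!%:R)^-1 *: iter j A p.

Definition Psys q A (n : nat) : {poly F} := exp_op (poly_op q A) 'X^n.

Definition opL q A p : {poly F} := poly_op q^`() A (A p) + 'X * opD p.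

Definition eigenfunction A (lam : F) p := p != 0 /\ A p = lam *: p.

Lemma lowers_degree_iter A p j :
  lowers_degree A -> (size (iter j A p) <= size p - j)%N.
Proof.
move=> lowA; elim: j => [|j IHj]; first by rewrite subn0.
rewrite iterS subnS; apply: leq_trans (lowA _) _.
by rewrite -!subn1 leq_sub2r.
Qed.

Lemma exp_opE A p N : lowers_degree A -> (size p <= N)%N ->
  \sum_(j < N) (j`!%:R)^-1 *: iter j A p = exp_op A p.
Proof.
move=> lowA leN; rewrite /exp_op -(subnKC leN) big_split_ord /=.
rewrite [X in _ + X]big1 ?addr0 // => j _.
have := lowers_degree_iter p (size p + j) lowA.
rewrite subnDA subnn sub0n leqn0 size_poly_eq0 => /eqP ->.
by rewrite scaler0.
Qed.

Lemma size_opH p : (size (opH p) <= size p)%N.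
Proof.
have [->|p0] := eqVneq p 0; first by rewrite /opH /opD deriv0 mulr0.
rewrite /opH mulrC; have [->|d0] := eqVneq (opD p) 0.
  by rewrite mul0r size_poly0.
by rewrite size_mulX // lt_size_deriv.
Qed.

Lemma size_opH1 p : (size (opH1 p) <= size p)%N.
Proof.
by apply: leq_trans (size_polyD _ _) _; rewrite geq_max size_opH leqnn.
Qed.

Lemma opG_lowers_degree S A :
  (forall p, (size (A p) <= size p)%N) -> lowers_degree (opG S A).
Proof.
move=> sA p; apply: leq_trans (size_sum _ _ _) _.
apply/bigmax_leqP => i _; apply: leq_trans (size_scale_leq _ _) _.
elim: (nat_of_ord i) => [|k IHk] /=; last exact: leq_trans (sA _) IHk.
have [->|p0] := eqVneq p 0; first by rewrite /opD deriv0 size_poly0.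
by rewrite -ltnS prednK ?size_poly_gt0 // lt_size_deriv.
Qed.

Lemma poly_op_lowers_degree q A :
  q`_0 = 0 -> lowers_degree A -> lowers_degree (poly_op q A).
Proof.
move=> q0 lowA p; apply: leq_trans (size_sum _ _ _) _.
apply/bigmax_leqP => -[[|i] ltiq] _ /=; first by rewrite q0 scale0r size_poly0.
apply: leq_trans (size_scale_leq _ _) _; rewrite -iterS.
apply: leq_trans (lowers_degree_iter p i.+1 lowA) _.
by rewrite -subn1 leq_sub2l.
Qed.

End Operators.

(* Main.v *)
Require Import Defs.
From HB Require Import structures.
From mathcomp Require Import all_boot all_order all_algebra.
From mathcomp Require Import reals.
From mathcomp Require Import complex.

Set Implicit Arguments.
Unset Strict Implicit.
Unset Printing Implicit Defensive.

Import Order.TTheory GRing.Theory Num.Theory.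
Local Open Scope ring_scope.

(** Write [D] for the derivation, [H = x D] and [Q = q(G)], and let [x] also
    denote multiplication by the variable. The three properties are
    commutation relations of [exp(Q)] with [H], [x] and [D], applied to the
    monomial [x^n].

    For [H] and [x] the tool is Hadamard's formula
    [T exp(A) = exp(A) (\sum_m (ad A)^m T / m!)] with [ad A T = T A - A T]
    ([exp_op_conj]), which is a finite sum as soon as [ad A] is nilpotent at [T].

    (i) As [G] lowers degrees by one, [H G = G (H - 1)], whence
    [ad Q H = - q'(G) G]. This commutes with [Q], so [(ad Q)^2 H = 0] and
    [H exp(Q) = exp(Q) H - q'(G) G exp(Q)], that is, [L exp(Q) = exp(Q) H].

    (ii) The operators [G^j f(H)] are stable under commutation with [G^k], which
    replaces [f] by a finite difference and [j] by [j + k]: the degree of [f]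
    drops by one, and [j] grows by at most [l] under [ad Q] ([normal_form_ad]).
    As [G x = (H + 1) R(H)], the first commutator [ad Q x] is a sum of such
    terms with [deg f <= d] and [j < l] ([normal_form_ad_opX]). Consequently
    [(ad Q)^m x = 0] for [m > d + 1], and the terms with [m <= d + 1] only
    involve [j < (d + 1) l]. Now [G^j f(H) x^n] is a multiple of [x^(n - j)], and
    applying [exp(Q)] gives the recurrence.

    (iii) Since [D H = (H + 1) D], the derivation satisfies [D G = Ghat D], hence
    [D exp(q(G)) = exp(q(Ghat)) D] ([exp_op_intertwine]). *)

(** * Linearity and polynomial functions of an operator *)

(** The sign is such that [T A = A T + ad A T], that is, [ad A T] is the
    correction paid for moving [A] from the right of [T] to its left. *)
Definition ad (V : zmodType) (A T : V -> V) v := T (A v) - A (T v).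

Section LinearOperators.
Variable F : fieldType.
Implicit Types (p S T : {poly F}).

Lemma opD_linear : linear (@opD F).
Proof. by move=> c p r; rewrite /opD linearP. Qed.
HB.instance Definition _ :=
  GRing.isLinear.Build F {poly F} {poly F} *:%R (@opD F) opD_linear.

Lemma opH_linear : linear (@opH F).
Proof. by move=> c p r; rewrite /opH linearP mulrDr scalerAr. Qed.
HB.instance Definition _ :=
  GRing.isLinear.Build F {poly F} {poly F} *:%R (@opH F) opH_linear.

Lemma opH1_linear : linear (@opH1 F).
Proof. by move=> c p r; rewrite /opH1 linearP scalerDr addrACA. Qed.
HB.instance Definition _ :=
  GRing.isLinear.Build F {poly F} {poly F} *:%R (@opH1 F) opH1_linear.

Definition opX p : {poly F} := 'X * p.

Lemma opX_linear : linear opX.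
Proof. by move=> c p r; rewrite /opX mulrDr scalerAr. Qed.
HB.instance Definition _ :=
  GRing.isLinear.Build F {poly F} {poly F} *:%R opX opX_linear.

Lemma iter_linear k (A : {linear {poly F} -> {poly F}}) : linear (iter k A).
Proof. by elim: k => [//|k IHk] c p r; rewrite !iterS IHk linearP. Qed.
HB.instance Definition _ k (A : {linear {poly F} -> {poly F}}) :=
  GRing.isLinear.Build F {poly F} {poly F} *:%R (iter k A) (iter_linear k A).

Lemma poly_op_linear S (A : {linear {poly F} -> {poly F}}) :
  linear (poly_op S A).
Proof.
move=> c p r; rewrite /poly_op scaler_sumr -big_split; apply: eq_bigr => i _.
by rewrite linearP scalerDr !scalerA mulrC.
Qed.
HB.instance Definition _ S (A : {linear {poly F} -> {poly F}}) :=
  GRing.isLinear.Build F {poly F} {poly F} *:%R (poly_op S A)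
    (poly_op_linear S A).

Lemma opG_linear S (A : {linear {poly F} -> {poly F}}) : linear (opG S A).
Proof. by move=> c p r; rewrite /opG !linearP. Qed.
HB.instance Definition _ S (A : {linear {poly F} -> {poly F}}) :=
  GRing.isLinear.Build F {poly F} {poly F} *:%R (opG S A) (opG_linear S A).

(** Every operator of interest acts on monomials by a scalar and a shift of the
    exponent, so identities between operators become scalar identities. *)
Lemma eq_linear_Xn (A B : {linear {poly F} -> {poly F}}) :
  (forall n, A 'X^n = B 'X^n) -> A =1 B.
Proof.
move=> eqAB p; rewrite -(coefK p) poly_def !linear_sum.
by apply: eq_bigr => i _; rewrite !linearZ eqAB.
Qed.

Lemma poly_op_widen S (A : {poly F} -> {poly F}) N p : (size S <= N)%N ->
  poly_op S A p = \sum_(i < N) S`_i *: iter i A p.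
Proof.
move=> leSN; rewrite /poly_op (big_ord_widen N (fun i => S`_i *: iter i A p)) //.
rewrite big_mkcond; apply: eq_bigr => i _.
by case: ltnP => // ltSi; rewrite nth_default ?scale0r.
Qed.

Lemma poly_opD S T (A : {poly F} -> {poly F}) p :
  poly_op (S + T) A p = poly_op S A p + poly_op T A p.
Proof.
have [leS leT] := (leq_maxl (size S) (size T), leq_maxr (size S) (size T)).
rewrite (poly_op_widen _ _ leS) (poly_op_widen _ _ leT).
rewrite (poly_op_widen _ _ (size_polyD S T)) -big_split.
by apply: eq_bigr => i _; rewrite coefD scalerDl.
Qed.

Lemma poly_opZ c S (A : {poly F} -> {poly F}) p :
  poly_op (c *: S) A p = c *: poly_op S A p.
Proof.
rewrite (poly_op_widen _ _ (size_scale_leq c S)) /poly_op scaler_sumr.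
by apply: eq_bigr => i _; rewrite coefZ scalerA.
Qed.

Lemma poly_opB S T (A : {poly F} -> {poly F}) p :
  poly_op (S - T) A p = poly_op S A p - poly_op T A p.
Proof. by rewrite poly_opD -[- T]scaleN1r poly_opZ scaleN1r. Qed.

Lemma poly_opC c (A : {poly F} -> {poly F}) p : poly_op c%:P A p = c *: p.
Proof.
by rewrite (poly_op_widen _ _ (size_polyC_leq1 c)) big_ord1 coefC.
Qed.

Lemma poly_opX (A : {poly F} -> {poly F}) p : poly_op 'X A p = A p.
Proof.
rewrite /poly_op size_polyX !big_ord_recl big_ord0 !coefX /=.
by rewrite scale0r add0r scale1r addr0.
Qed.

Lemma poly_op_no_const S (A : {poly F} -> {poly F}) p : S`_0 = 0 ->
  poly_op S A p = \sum_(i < (size S).-1) S`_i.+1 *: iter i.+1 A p.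
Proof.
move=> S0; rewrite (poly_op_widen A p (leqSpred (size S))) big_ord_recl S0.
by rewrite scale0r add0r.
Qed.

(** Intertwining passes from [A], [B] to the powers [A^i], [B^i], hence to their
    linear combinations. *)
Lemma poly_op_intertwine (T : {linear {poly F} -> {poly F}})
    (A B : {poly F} -> {poly F}) S p :
  (forall r, T (A r) = B (T r)) -> T (poly_op S A p) = poly_op S B (T p).
Proof.
move=> TAB; rewrite /poly_op linear_sum; apply: eq_bigr => i _.
by rewrite linearZ /=; congr (_ *: _); elim: (val i) => //= k <-.
Qed.

Lemma poly_op_comm S T (A : {linear {poly F} -> {poly F}}) p :
  poly_op S A (poly_op T A p) = poly_op T A (poly_op S A p).
Proof.
apply: poly_op_intertwine => r; apply/esym.
exact: poly_op_intertwine.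
Qed.

(** The operator [S(A) A] is a polynomial in [A], so it commutes with [T(A)]. *)
Lemma poly_op_comm_mul S T (A : {linear {poly F} -> {poly F}}) p :
  poly_op S A (A (poly_op T A p)) = poly_op T A (poly_op S A (A p)).
Proof. by rewrite (@poly_op_intertwine A A A) // poly_op_comm. Qed.

End LinearOperators.

(** * Exponentials of degree-lowering operators *)

Section Exponential.
Variable F : numFieldType.
Implicit Types (p : {poly F}).

(** The truncation index of [exp_op] depends on the argument; a common bound for
    the three arguments makes the sums comparable. *)
Lemma exp_op_linear (A : {linear {poly F} -> {poly F}}) :
  lowers_degree A -> linear (exp_op A).
Proof.
move=> lowA c p r; set N := maxn (size (c *: p + r)) (maxn (size p) (size r)).
rewrite -!(@exp_opE _ _ _ N lowA) ?leq_max ?leqnn ?orbT //.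
rewrite scaler_sumr -big_split; apply: eq_bigr => i _.
by rewrite linearP scalerDr !scalerA mulrC.
Qed.

(** Linearity of [exp_op A] depends on the hypothesis that [A] lowers degrees,
    so it cannot be inferred from [A]; this form packages it on demand. *)
Lemma exp_op_linearP (A : {linear {poly F} -> {poly F}}) : lowers_degree A ->
  exists E : {linear {poly F} -> {poly F}}, exp_op A = E.
Proof.
move=> lowA; pose E : {linear {poly F} -> {poly F}} := HB.pack (exp_op A)
  (GRing.isLinear.Build F {poly F} {poly F} *:%R (exp_op A)
     (exp_op_linear lowA)).
by exists E.
Qed.

(** The terms of positive index have smaller degree than [p], hence cannot
    cancel it. *)
Lemma exp_op_neq0 (A : {poly F} -> {poly F}) p :
  lowers_degree A -> p != 0 -> exp_op A p != 0.
Proof.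
move=> lowA; rewrite -size_poly_gt0 => p_gt0.
rewrite /exp_op -(prednK p_gt0) big_ord_recl fact0 invr1 scale1r /= addr_eq0.
apply/eqP => p_eq; suff: (size p <= (size p).-1)%N by rewrite leqNgt ltn_predL p_gt0.
rewrite {1}p_eq size_polyN; apply: leq_trans (size_sum _ _ _) _.
apply/bigmax_leqP => i _; apply: leq_trans (size_scale_leq _ _) _.
apply: leq_trans (lowers_degree_iter p i.+1 lowA) _.
by rewrite leq_subLR addSnnS prednK // leq_addl.
Qed.

Lemma exp_op_intertwine (T : {linear {poly F} -> {poly F}})
    (A B : {poly F} -> {poly F}) p :
    lowers_degree A -> lowers_degree B -> (forall r, T (A r) = B (T r)) ->
  T (exp_op A p) = exp_op B (T p).
Proof.
move=> lowA lowB TAB; set N := maxn (size p) (size (T p)).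
rewrite -(@exp_opE _ A p N) ?leq_maxl // -(@exp_opE _ B _ N) ?leq_maxr //.
rewrite linear_sum; apply: eq_bigr => i _.
by rewrite linearZ /=; congr (_ *: _); elim: (val i) => //= k <-.
Qed.

(** Right multiplication of operators by [A] is the sum of left multiplication
    by [A] and of [ad A], and these two commute: the formula is the binomial
    theorem for the [n]-th power of that sum. *)
Lemma iter_ad_binomial (T : {poly F} -> {poly F}) (A : {linear {poly F} -> {poly F}})
    n p :
  T (iter n A p) =
  \sum_(m < n.+1) iter (n - m) A (iter m (ad A) T p) *+ 'C(n, m).
Proof.
elim: n T => [|n IHn] T; first by rewrite big_ord1 mulr1n.
have -> : T (iter n.+1 A p) = A (T (iter n A p)) + ad A T (iter n A p).
  by rewrite /ad addrC subrK iterS.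
rewrite !IHn linear_sum big_ord_recl [RHS]big_ord_recl !subn0 !bin0 -addrA.
congr (_ + _).
under [in RHS]eq_bigr => i _ do rewrite /= add0n subSS binS mulrnDr.
rewrite big_split /=; congr (_ + _); last first.
  by apply: eq_bigr => i _; rewrite -iterSr.
rewrite [RHS]big_ord_recr /= bin_small // mulr0n addr0.
by apply: eq_bigr => i _; rewrite raddfMn -[(n - i)%N](subnSK (ltn_ord i)).
Qed.

(** Hadamard's formula [exp(-A) T exp(A) = exp(ad A) T], written without
    [exp(-A)]. Dividing the binomial theorem by [j!] turns the exponential
    series into the Cauchy product of the series of [exp(A)] and of
    [exp(ad A)]; nilpotency of [ad A] at [T] makes the latter a finite sum. *)
Lemma exp_op_conj (T A : {linear {poly F} -> {poly F}}) M p :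
    lowers_degree A -> (forall r, iter M (ad A) T r = 0) ->
  T (exp_op A p) =
  exp_op A (\sum_(m < M) (m`!%:R)^-1 *: iter m (ad A) T p).
Proof.
move=> lowA TM0.
pose C m := iter m (ad A) T p.
have C0 m : (M <= m)%N -> C m = 0.
  rewrite /C => /subnK <-.
  have: forall r, iter (m - M + M) (ad A) T r = 0; last by [].
  by elim: (m - M)%N => //= k IHk r; rewrite /ad !IHk linear0 subrr.
(* [N] bounds the sizes of [p] and of all [C m], even after the shift by
   [m < M] that the Cauchy product causes. *)
pose N := (M + maxn (size p) (\max_(m < M) size (C m)))%N.
have leMN : (M <= N)%N by exact: leq_addr.
have term m : (m < M)%N ->
    exp_op A (C m) =
    \sum_(j < N | (m <= j)%N) ((j - m)`!%:R)^-1 *: iter (j - m) A (C m).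
  move=> ltmM; have lemN : (m <= N)%N := leq_trans (ltnW ltmM) leMN.
  rewrite -(@exp_opE _ A _ (N - m)%N) //; last first.
    rewrite leq_subRL // leq_add ?(ltnW ltmM) // leq_max.
    by rewrite (leq_bigmax (Ordinal ltmM)) orbT.
  rewrite -(big_mkord xpredT (fun j => (j`!%:R)^-1 *: iter j A (C m))).
  rewrite -(big_mkord (leq m)
    (fun j => ((j - m)`!%:R)^-1 *: iter (j - m) A (C m))).
  rewrite [RHS](@big_cat_nat _ _ _ m) //= [X in X + _]big_nat_cond.
  rewrite [X in X + _]big1 ?add0r => [|i /andP[/andP[_ ltim]]]; last first.
    by rewrite leqNgt ltim.
  rewrite (big_addn 0 N m); apply: eq_big => [i|i _]; last by rewrite addnK.
  by rewrite leq_addl.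
have -> : exp_op A (\sum_(m < M) (m`!%:R)^-1 *: C m) =
    \sum_(m < M) (m`!%:R)^-1 *: exp_op A (C m).
  have [E ->] := exp_op_linearP lowA.
  by rewrite linear_sum; apply: eq_bigr => m _; rewrite linearZ.
under eq_bigr => m _ do rewrite term // scaler_sumr.
rewrite (exchange_big_dep xpredT) //=.
rewrite -(@exp_opE _ A p N) // ?linear_sum; last first.
  exact: leq_trans (leq_maxl _ _) (leq_addl _ _).
apply: eq_bigr => j _; rewrite linearZ /= iter_ad_binomial scaler_sumr.
pose f m := ((m`!%:R)^-1 * ((j - m)`!%:R)^-1 : F) *: iter (j - m) A (C m).
transitivity (\sum_(m < N | (m <= j)%N) f m).
  rewrite (big_ord_widen N (fun m => (j`!%:R)^-1 *:
    (iter (j - m) A (iter m (ad A) T p) *+ 'C(j, m)))) //.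
  apply: eq_bigr => m lemj; rewrite -scaler_nat scalerA /f; congr (_ *: _).
  rewrite -(@bin_fact j m lemj) natrM invfM mulrAC mulVf ?mul1r ?natrM ?invfM //.
  by rewrite pnatr_eq0 -lt0n bin_gt0.
rewrite (big_ord_widen_cond N (geq j) (fun m => (m`!%:R)^-1 *:
  (((j - m)`!%:R)^-1 *: iter (j - m) A (C m)))) //.
rewrite [LHS](bigID (fun m : 'I_N => m < M)%N) /=.
rewrite [X in _ + X]big1 ?addr0 => [|m /andP[_]].
  by apply: eq_bigr => m _; rewrite scalerA.
by rewrite -leqNgt => leMm; rewrite /f C0 // linear0 scaler0.
Qed.
End Exponential.

(** * Normal forms of operators *)

Section NormalForm.
Variable F : fieldType.
Implicit Types (p q R S f : {poly F}).

Local Notation H := (@opH F).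

Lemma opD_Xn n : opD ('X^n : {poly F}) = n%:R *: 'X^(n.-1).
Proof. by rewrite /opD derivXn scaler_nat. Qed.

(** Monomials are the eigenvectors of [H]. *)
Lemma poly_op_opH_Xn f n : poly_op f H 'X^n = f.[n%:R] *: 'X^n.
Proof.
have iterH i : iter i H 'X^n = n%:R ^+ i *: 'X^n.
  elim: i => [|i IHi]; first by rewrite scale1r.
  rewrite iterS IHi linearZ /= /opH opD_Xn -scalerAr exprSr -scalerA.
  congr (_ *: _); case: n {IHi} => [|n]; first by rewrite !scale0r.
  by rewrite -exprS.
rewrite /poly_op horner_coef scaler_suml.
by apply: eq_bigr => i _; rewrite iterH scalerA.
Qed.

Lemma opG_Xn R n : opG R H 'X^n = (n%:R * R.[n.-1%:R]) *: 'X^(n.-1).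
Proof. by rewrite /opG opD_Xn linearZ /= poly_op_opH_Xn scalerA. Qed.

Lemma iter_opG_Xn R j n :
  exists c, iter j (opG R H) 'X^n = (if (j <= n)%N then c else 0) *: 'X^(n - j).
Proof.
have [lejn|ltnj] := leqP j n; last first.
  exists 0; rewrite scale0r; apply/eqP; rewrite -size_poly_eq0 -leqn0.
  apply: leq_trans (lowers_degree_iter _ _ (opG_lowers_degree _ (@size_opH F))) _.
  by rewrite size_polyXn leqn0 subn_eq0.
elim: j lejn => [|j IHj] ltjn; first by exists 1; rewrite scale1r subn0.
have [c IHc] := IHj (ltnW ltjn); rewrite iterS IHc linearZ /= opG_Xn scalerA subnS.
by eexists.
Qed.

(** [G] lowers the eigenvalue of [H] by one, so that [H G = G (H - 1)]. *)
Lemma poly_op_opH_iter_opG R f k p :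
  poly_op f H (iter k (opG R H) p) =
  iter k (opG R H) (poly_op (f \Po ('X - k%:R%:P)) H p).
Proof.
have := @eq_linear_Xn F (poly_op f H \o iter k (opG R H))
  (iter k (opG R H) \o poly_op (f \Po ('X - k%:R%:P)) H).
apply=> n /=; rewrite poly_op_opH_Xn linearZ /=.
have [c ->] := iter_opG_Xn R k n; case: ifP => [lekn|_]; last first.
  by rewrite scale0r linear0 scaler0.
by rewrite linearZ /= poly_op_opH_Xn horner_comp !hornerE -natrB // !scalerA mulrC.
Qed.

(** A finite difference loses one degree because a translation preserves the
    leading coefficient. *)
Lemma size_comp_shiftB f c s : (size f <= s)%N ->
  (size (f \Po ('X - c%:P) - f)%R <= s.-1)%N.
Proof.
have [->|f0] := eqVneq f 0; first by rewrite comp_poly0 subr0 size_poly0.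
move=> lefs; have size_comp : size (f \Po ('X - c%:P)) = size f.
  exact: size_comp_poly2 (size_XsubC c).
apply/leq_sizeP => j lesj; rewrite coefB.
have [ltfj|] := ltnP (size f) j.+1; first by rewrite !nth_default ?subrr ?size_comp.
move=> ltjf; have szf : size f = j.+1.
  apply/anti_leq; rewrite ltjf (leq_trans lefs) //.
  exact: leq_trans (leqSpred s) _.
have -> : j = (size f).-1 by rewrite szf.
rewrite -{1}size_comp -!lead_coefE lead_coef_comp ?size_XsubC //.
by rewrite lead_coefXsubC expr1n mulr1 subrr.
Qed.

(** Operators [\sum_(j < J) G^j f_j(H)] with [deg f_j < s]. The two parameters
    react in opposite ways to [ad q(G)]: the order [J] grows, while the bound
    [s] on the degrees decreases, which forces nilpotency. *)
Definition normal_form R s J (T : {poly F} -> {poly F}) :=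
  exists2 f : nat -> {poly F}, forall j, (size (f j) <= s)%N &
    forall p, T p = \sum_(j < J) iter j (opG R H) (poly_op (f j) H p).

Lemma normal_form_eq R s J T U : T =1 U -> normal_form R s J T ->
  normal_form R s J U.
Proof. by move=> eqTU [f szf Tf]; exists f => // p; rewrite -eqTU. Qed.

Lemma normal_form_widen R s s' J J' T : (s <= s')%N -> (J <= J')%N ->
  normal_form R s J T -> normal_form R s' J' T.
Proof.
move=> les leJ [f szf Tf]; exists (fun j => if (j < J)%N then f j else 0) => [j|p].
  by case: ifP => _; rewrite ?size_poly0 // (leq_trans (szf j)).
rewrite Tf (big_ord_widen J' (fun j => iter j (opG R H) (poly_op (f j) H p))) //.
rewrite big_mkcond; apply: eq_bigr => j _; case: ifP => // _.
by rewrite poly_opC scale0r linear0.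
Qed.

Lemma normal_form0 R s J : normal_form R s J (fun=> 0).
Proof.
exists (fun=> 0) => [j|p]; first by rewrite size_poly0.
by rewrite big1 // => j _; rewrite poly_opC scale0r linear0.
Qed.

Lemma normal_form_size0 R J T : normal_form R 0 J T -> T =1 fun=> 0.
Proof.
move=> [f szf Tf] p; rewrite Tf big1 // => j _.
have /eqP -> : f j == 0 by rewrite -size_poly_leq0.
by rewrite poly_opC scale0r linear0.
Qed.

Lemma normal_formD R s J T U : normal_form R s J T -> normal_form R s J U ->
  normal_form R s J (fun p => T p + U p).
Proof.
move=> [f szf Tf] [g szg Ug]; exists (fun j => f j + g j) => [j|p].
  by apply: leq_trans (size_polyD _ _) _; rewrite geq_max szf szg.
rewrite Tf Ug -big_split; apply: eq_bigr => j _.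
by rewrite poly_opD linearD.
Qed.

Lemma normal_formZ R s J c T : normal_form R s J T ->
  normal_form R s J (fun p => c *: T p).
Proof.
move=> [f szf Tf]; exists (fun j => c *: f j) => [j|p].
  exact: leq_trans (size_scale_leq _ _) (szf j).
rewrite Tf scaler_sumr; apply: eq_bigr => j _.
by rewrite poly_opZ linearZ.
Qed.

Lemma normal_form_sum R s J N (T : nat -> {poly F} -> {poly F}) :
  (forall i, (i < N)%N -> normal_form R s J (T i)) ->
  normal_form R s J (fun p => \sum_(i < N) T i p).
Proof.
elim: N => [|N IHN] TN.
  by apply: normal_form_eq (normal_form0 _ _ _) => p; rewrite big_ord0.
apply: (@normal_form_eq _ _ _ (fun p => \sum_(i < N) T i p + T N p)).
  by move=> p; rewrite big_ord_recr.
apply: normal_formD; last exact: TN.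
by apply: IHN => i ltiN; apply: TN; apply: ltnW.
Qed.

Lemma normal_form_term R s J r f : (size f <= s)%N -> (r < J)%N ->
  normal_form R s J (fun p => iter r (opG R H) (poly_op f H p)).
Proof.
move=> szf ltrJ; exists (fun j => if j == r then f else 0) => [j|p].
  by case: ifP; rewrite ?size_poly0.
rewrite (bigD1 (Ordinal ltrJ)) //= eqxx big1 ?addr0 // => j.
rewrite -val_eqE /= => /negPf ->; by rewrite poly_opC scale0r linear0.
Qed.

(** Since [f(H) G^k = G^k f(H - k)], the commutator of [G^j f(H)] with [G^k] is
    [G^(j + k)] times the finite difference [f(H - k) - f(H)], whose degree is
    smaller than that of [f]. *)
Lemma normal_form_ad R q s J T : normal_form R s J T -> q`_0 = 0 ->
  normal_form R s.-1 (J + (size q).-1) (ad (poly_op q (opG R H)) T).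
Proof.
set G := opG R H; move=> [f szf Tf] q0.
pose g k j := f j \Po ('X - k%:R%:P) - f j.
apply: (@normal_form_eq _ _ _ (fun p => \sum_(j < J) \sum_(i < (size q).-1)
    q`_i.+1 *: iter (j + i.+1) G (poly_op (g i.+1 j) H p))).
  move=> p; rewrite /ad !Tf [poly_op q G (\sum_(_ < _) _)]linear_sum -sumrB.
  apply: eq_bigr => j _ /=; rewrite !(poly_op_no_const _ _ q0).
  rewrite [poly_op (f j) H _]linear_sum [iter j _ (\sum_(_ < _) _)]linear_sum.
  rewrite -sumrB.
  apply: eq_bigr => i _; rewrite !linearZ /= -scalerDr; congr (_ *: _).
  rewrite -!iterS poly_op_opH_iter_opG -!iterD addnC -linearB -poly_opB.
  by rewrite addnC.
apply: (@normal_form_sum _ _ _ _ (fun j p => \sum_(i < (size q).-1)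
  q`_i.+1 *: iter (j + i.+1) G (poly_op (g i.+1 j) H p))) => j ltjJ.
apply: (@normal_form_sum _ _ _ _ (fun i p =>
  q`_i.+1 *: iter (j + i.+1) G (poly_op (g i.+1 j) H p))) => i ltiq.
apply: normal_formZ; apply: normal_form_term; first exact: size_comp_shiftB.
by rewrite -addSn leq_add.
Qed.

(** Multiplication by [x] is not of the form [G^j f(H)], but its products with
    [G] on either side preserve monomials and are therefore polynomials in
    [H]. *)
Lemma opG_opX R p : opG R H (opX p) = poly_op (('X + 1) * R) H p.
Proof.
apply: (@eq_linear_Xn F (opG R H \o @opX F) (poly_op (('X + 1) * R) H)) => n /=.
by rewrite /opX -exprS opG_Xn poly_op_opH_Xn !hornerE natr1.
Qed.

Lemma opX_opG R p :
  opX (opG R H p) = poly_op ((('X + 1) * R) \Po ('X - 1%:P)) H p.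
Proof.
apply: (@eq_linear_Xn F (@opX F \o opG R H)
  (poly_op ((('X + 1) * R) \Po ('X - 1%:P)) H)) => n /=.
rewrite opG_Xn poly_op_opH_Xn linearZ /= horner_comp !hornerE subrK /opX -exprS.
by case: n => [|n]; rewrite ?mul0r ?scale0r // -[n.+1%:R]natr1 addrK.
Qed.

(** With [G x = u(H)], where [u = (X + 1) R], one has [x G = u(H - 1)], hence
    [x G^(i + 1) - G^(i + 1) x = G^i (u(H - i - 1) - u(H))]: a finite difference
    of a polynomial of degree [deg R + 1]. *)
Lemma normal_form_ad_opX R q : q`_0 = 0 ->
  normal_form R (size R) (size q).-1 (ad (poly_op q (opG R H)) (@opX F)).
Proof.
set G := opG R H; move=> q0; set u := ('X + 1) * R.
apply: (@normal_form_eq _ _ _ (fun p => \sum_(i < (size q).-1)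
    q`_i.+1 *: iter i G (poly_op (u \Po ('X - i.+1%:R%:P) - u) H p))).
  move=> p; rewrite /ad !(poly_op_no_const _ _ q0).
  rewrite [opX (\sum_(_ < _) _)]linear_sum -sumrB.
  apply: eq_bigr => i _; rewrite linearZ /= -scalerBr; congr (_ *: _).
  rewrite -[G (iter i G (opX p))]iterS iterSr /G.
  rewrite opG_opX opX_opG poly_op_opH_iter_opG -/u.
  rewrite -linearB -poly_opB -comp_polyA; congr (iter _ _ (poly_op (_ \Po _ - _) _ _)).
  rewrite comp_polyB comp_polyX comp_polyC -addrA -opprD -polyCD -natr1.
  by rewrite addrC.
apply: (@normal_form_sum _ _ _ _ (fun i p =>
  q`_i.+1 *: iter i G (poly_op (u \Po ('X - i.+1%:R%:P) - u) H p))) => i ltiq.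
apply: normal_formZ.
apply: normal_form_term => //; apply: (@size_comp_shiftB _ _ (size R).+1).
apply: leq_trans (size_polyMleq _ _) _.
by rewrite -[1]opprK -[1]/(1%:P) -polyCN size_XsubC.
Qed.

End NormalForm.

(** * The three properties *)

Section Properties.
Variable F : numFieldType.
Implicit Types (p q R : {poly F}).

Local Notation H := (@opH F).

Lemma opG_opH_lowers_degree R : lowers_degree (opG R H).
Proof. exact: opG_lowers_degree (@size_opH F). Qed.

(** The relation [H G = G (H - 1)] iterates to [H G^i = G^i H - i G^i], and
    [\sum_i i q_i G^i = q'(G) G]. *)
Lemma ad_opH R q p : q`_0 = 0 ->
  ad (poly_op q (opG R H)) H p = - poly_op q^`() (opG R H) (opG R H p).
Proof.
move=> q0; have iterG i : H (iter i (opG R H) p) =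
    iter i (opG R H) (H p) - i%:R *: iter i (opG R H) p.
  rewrite -[LHS](poly_opX H) poly_op_opH_iter_opG comp_polyX poly_opB poly_opX.
  by rewrite poly_opC linearB linearZ.
rewrite (poly_op_widen _ _ (size_poly _ _)) /ad !(poly_op_no_const _ _ q0).
rewrite [H (\sum_(_ < _) _)]linear_sum -sumrB -sumrN.
apply: eq_bigr => i _; rewrite [X in X - _]linearZ -scalerBr.
rewrite [X in _ *: (X - _)]iterG addrAC subrr add0r.
by rewrite scalerN scalerA coef_poly ltn_ord mulr_natr iterSr.
Qed.

(** The commutator of [H] with [q(G)] is a polynomial in [G], so it commutes with
    [q(G)] and Hadamard's formula stops after two terms. *)
Lemma opH_exp_op R q p : q`_0 = 0 ->
  let G := opG R H in
  H (exp_op (poly_op q G) p) =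
  exp_op (poly_op q G) (H p - poly_op q^`() G (G p)).
Proof.
move=> q0 G; have lowQ := poly_op_lowers_degree q0 (opG_opH_lowers_degree R).
rewrite (@exp_op_conj _ H (poly_op q G) 2) //.
  rewrite !big_ord_recl big_ord0 /= addr0 fact0 invr1 !scale1r.
  by rewrite ad_opH.
move=> r /=; rewrite {1}/ad !ad_opH // linearN opprK -/G.
by rewrite (poly_op_comm_mul q^`() q G) addNr.
Qed.

(** Moving [H] through [exp(q(G))] produces [- q'(G) G], which is exactly what the
    first summand of [L] compensates: [L exp(q(G)) = exp(q(G)) H]. *)
Lemma opL_Psys R q n : q`_0 = 0 ->
  opL q (opG R H) (Psys q (opG R H) n) = n%:R *: Psys q (opG R H) n.
Proof.
move=> q0; set G := opG R H.
have lowQ := poly_op_lowers_degree q0 (opG_opH_lowers_degree R).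
have BexpQ p : poly_op q^`() G (G (exp_op (poly_op q G) p)) =
    exp_op (poly_op q G) (poly_op q^`() G (G p)).
  apply: (@exp_op_intertwine _ (poly_op q^`() G \o G)) => // r.
  exact: (poly_op_comm_mul _ _ G).
rewrite /opL /Psys -/(H _) opH_exp_op // -/G BexpQ.
have [E ->] := exp_op_linearP lowQ.
by rewrite -linearD addrC subrK -(poly_opX H) poly_op_opH_Xn hornerX linearZ.
Qed.

(** From [D H = (H + 1) D], where [D] is the derivation, follows [D G = Ghat D],
    and this intertwining passes to polynomials and to exponentials. *)
Lemma opD_Psys R q n : q`_0 = 0 ->
  opD (Psys q (opG R H) n) = n%:R *: Psys q (opG R (@opH1 F)) n.-1.
Proof.
move=> q0; have lowG1 := opG_lowers_degree R (@size_opH1 F).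
rewrite /Psys (@exp_op_intertwine _ (@opD F) _ (poly_op q (opG R (@opH1 F)))).
- have [E ->] := exp_op_linearP (poly_op_lowers_degree q0 lowG1).
  by rewrite /= opD_Xn linearZ.
- exact: poly_op_lowers_degree q0 (opG_opH_lowers_degree R).
- exact: poly_op_lowers_degree q0 lowG1.
move=> r; apply: poly_op_intertwine => {}r; rewrite /opG.
apply: poly_op_intertwine => {}r.
by rewrite /= /opH1 /opH /opD derivM derivX mul1r addrC.
Qed.

Lemma normal_form_iter_ad_opX R q m : q`_0 = 0 ->
  normal_form R (size R - m) (m.+1 * (size q).-1)
    (iter m.+1 (ad (poly_op q (opG R H))) (@opX F)).
Proof.
move=> q0; elim: m => [|m IHm].
  by rewrite subn0 mul1n; apply: normal_form_ad_opX.
by rewrite subnS mulSn addnC; apply: normal_form_ad.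
Qed.

(** By Hadamard's formula [x exp(q(G)) = exp(q(G)) (x + T)], where [T] collects the
    iterated commutators. These vanish from the index [size R + 1] on, and the
    others have normal forms of order at most [size R * deg q], which is the
    length of the recurrence. Each [G^j f(H)] sends [x^n] to a multiple of
    [x^(n - j)]. *)
Lemma opX_Psys R q : q`_0 = 0 ->
  exists gamma : nat -> nat -> F, forall n : nat,
    opX (Psys q (opG R H) n) = Psys q (opG R H) n.+1 +
      \sum_(j < size R * (size q).-1 | (j <= n)%N)
        gamma j n *: Psys q (opG R H) (n - j)%N.
Proof.
move=> q0; set G := opG R H; set Q := poly_op q G; set J := (_ * _)%N.
have lowQ : lowers_degree Q := poly_op_lowers_degree q0 (opG_opH_lowers_degree R).
pose T p := \sum_(m < size R) (m.+1`!%:R)^-1 *: iter m.+1 (ad Q) (@opX F) p.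
have [f _ Tf] : normal_form R (size R) J T.
  apply: (@normal_form_sum _ _ _ _ _ (fun m p =>
    (m.+1`!%:R)^-1 *: iter m.+1 (ad Q) (@opX F) p)) => m ltmR.
  apply: normal_formZ; apply: normal_form_widen (normal_form_iter_ad_opX R m q0).
    exact: leq_subr.
  by rewrite leq_mul2r ltmR orbT.
exists (fun j n => (iter j G 'X^n)`_(n - j) * (f j).[n%:R]) => n.
rewrite /Psys (@exp_op_conj _ (@opX F) Q (size R).+1) //; last first.
  apply: (@normal_form_size0 _ R ((size R).+1 * (size q).-1)).
  by have := normal_form_iter_ad_opX R (size R) q0; rewrite subnn.
have [E ->] := exp_op_linearP lowQ.
rewrite big_ord_recl fact0 invr1 scale1r [X in _ + X](_ : _ = T 'X^n) //.
rewrite linearD /= /opX -exprS; congr (_ + _).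
rewrite Tf linear_sum [RHS]big_mkcond; apply: eq_bigr => j _.
rewrite poly_op_opH_Xn linearZ /= -/G.
have [c Gc] := iter_opG_Xn R j n; rewrite !{}Gc.
case: ifP => _; last by rewrite scale0r !linear0.
by rewrite coefZ coefXn eqxx mulr1 scalerA linearZ mulrC.
Qed.

End Properties.

Theorem theorem2p3 (K : realType) (R q : {poly K[i]})
    (R_neq0 : R != 0) (q_no_const : q`_0 = 0) :
  let d := (size R).-1 in
  let l := (size q).-1 in
  let G := opG R (@opH _) in
  let Ghat := opG R (@opH1 _) in
  let P := Psys q G in
  [/\ forall n : nat, eigenfunction (opL q G) n%:R (P n),
      exists gamma : nat -> nat -> K[i], forall n : nat,
        'X * P n = P n.+1
          + \sum_(j < l * d + l | (j <= n)%N) gamma j n *: P (n - j)%N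
    & forall n : nat, (1 <= n)%N ->
        n%:R^-1 *: opD (P n) = Psys q Ghat n.-1].
Proof.
move=> d l G Ghat P.
have lowQ := poly_op_lowers_degree q_no_const (opG_opH_lowers_degree R).
split=> [n||n n_gt0].
- split; last exact: opL_Psys.
  by apply: exp_op_neq0; rewrite ?monic_neq0 ?monicXn.
- have -> : (l * d + l = size R * l)%N.
    by rewrite addnC -mulnS prednK ?size_poly_gt0 // mulnC.
  exact: opX_Psys.
- by rewrite opD_Psys // scalerA mulVf ?scale1r // pnatr_eq0 -lt0n.
Qed.
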